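(* Let $n\ge1$ and let $\mu_n=\mu\times\cdots\times\mu$ be the product Kusuoka measure on $\mathbb{S}^n$. For a positive Radon measure $\sigma$ on $\mathbb S^n$ consider the following two conditions on constants $0<\underline{\delta}\le\overline{\delta}\le\infty$. Condition (M), where $\overline\delta\ge1$: there is $C_\sigma>0$ such that for all dyadic simplexes $S\subseteq\mathbb S^n$, $\sigma(S)\le C_\sigma\nu_n(S)^{1/\overline\delta}$ if $0<\mathrm{diam}(S)\le1$, and $\sigma(S)\le C_\sigma\nu_n(S)^{1/\underline\delta}$ if $\mathrm{diam}(S)>1$. Condition (M'), where $\underline\delta\le1$: there is $C_\sigma>0$ such that for all dyadic simplexes $S\subseteq\mathbb S^n$, $C_\sigma^{-1}\nu_n(S)^{1/\underline\delta}\le\sigma(S)$ if $0<\mathrm{diam}(S)\le1$, and $C_\sigma^{-1}\nu_n(S)^{1/\overline\delta}\le\sigma(S)$ if $\mathrm{diam}(S)>1$. (a) The measure $\sigma=\mu_n$ satisfies (M) with $\underline\delta=1$ and $\overline\delta=\delta_s$. Conversely, if $\mu_n$ satisfies (M) for some $\underline\delta$ and $\overline\delta$, then $\underline\delta\le1$ and $\overline\delta\ge\delta_s$. (b) The measure $\sigma=\mu_n$ satisfies (M') with $\underline\delta=(1+1/\delta_s)^{-1}$ and $\overline\delta=1$. Conversely, if $\mu_n$ satisfies (M') for some $\underline\delta$ and $\overline\delta$, then $\underline\delta\le(1+1/\delta_s)^{-1}$ and $\overline\delta\ge1$.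
   Context: Conventions: $1/\infty=0$, $\delta_s=\frac{1}{2/d_s-1}$ with $d_s=\frac{2\log 3}{\log 5}$ (so $3^{1/\delta_s}=5/3$). Let $p_1=(0,0)$, $p_2=(1,0)$, $p_3=(1/2,\sqrt3/2)$, $\mathrm V_{0,0}=\{p_1,p_2,p_3\}$, $\mathbf F_i(x)=\frac12(x+p_i)$ on $\mathbb R^2$, $\mathrm V_{0,m}=\bigcup_{i=1}^3\mathbf F_i(\mathrm V_{0,m-1})$. $\mathbb S_0$ is the closure of $\bigcup_m\mathrm V_{0,m}$ and $\mathbb S=\bigcup_{m\ge0}\mathbf F_1^{-m}[\mathbb S_0\cup(-\mathbb S_0)]$. Write $\mathbb S=\bigcup_{i\in\mathbb Z}\mathbb S_i$ where the $\mathbb S_i$ are the non-overlapping unit cells, $\mathbb S_i=\tau_i(\mathbb S_0)$ with $\tau_i(x)=\pm x+c_i$ ($\mathbb S_i$ is a translate of $\mathbb S_0$ or of $-\mathbb S_0$; $\tau_0=\mathrm{id}$). $\mathrm W_*$ is the set of infinite sequences $\omega=\omega_1\omega_2\dots$ in $\{1,2,3\}$, and $\mathbf F_{[\omega]_m}=\mathbf F_{\omega_1}\circ\cdots\circ\mathbf F_{\omega_m}$. $\nu$ is the Borel measure on $\mathbb S$ with $\nu(\tau_i\mathbf F_{[\omega]_m}(\mathbb S_0))=3^{-m}$ for all $i,m,\omega$, and $\nu_n=\nu\times\cdots\times\nu$ on $\mathbb S^n$. For $i\in\mathbb Z^n$ put $\mathbb S^n_i=\mathbb S_{i_1}\times\cdots\times\mathbb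 S_{i_n}$, and let $\mathbf F_{(1,\dots,1)}$ act as $\mathbf F_1$ on each coordinate. Dyadic simplexes in $\mathbb S^n$ are the sets $\mathbf F_{(1,\dots,1)}^{-m}(\mathbb S^n_i)$, $m\in\mathbb Z$, $i\in\mathbb Z^n$; $\mathrm{diam}$ is taken in the metric $\max_k|x_k-y_k|$, so that this set has diameter $2^m$ (and $\nu_n$-measure $3^{mn}$). Let $\mathbf Y_1=\frac15\begin{pmatrix}2&-1&-1\\-1&1&0\\-1&0&1\end{pmatrix}$, $\mathbf Y_2=\frac15\begin{pmatrix}1&-1&0\\-1&2&-1\\0&-1&1\end{pmatrix}$, $\mathbf Y_3=\frac15\begin{pmatrix}1&0&-1\\0&1&-1\\-1&-1&2\end{pmatrix}$, and $\mathbf Y_{[\omega]_m}=\mathbf Y_{\omega_m}\cdots\mathbf Y_{\omega_1}$. The Kusuoka measure $\mu$ is the Borel measure on $\mathbb S$ with $\mu(\tau_i\mathbf F_{[\omega]_m}(\mathbb S_0))=\frac12(\frac53)^m\,\mathrm{trace}(\mathbf Y_{[\omega]_m}^{\mathrm t}\mathbf Y_{[\omega]_m})$ for all $m\ge1$, $i\in\mathbb Z$, $\omega\in\mathrm W_*$, and $\mu(\mathbb S_i)=1$. *)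

(* Defs.v *)
From HB Require Import structures.
From mathcomp Require Import all_boot all_order all_algebra.
From mathcomp Require Import all_classical all_reals all_analysis.

Set Implicit Arguments.
Unset Strict Implicit.
Unset Printing Implicit Defensive.

Import Order.TTheory GRing.Theory Num.Theory.
Import numFieldNormedType.Exports.

Local Open Scope classical_set_scope.
Local Open Scope ring_scope.

(* The indices 1, 2, 3 are the elements 0, 1, 2 of 'I_3, and a word
   omega_1 omega_2 ... is a function w with w k = omega_(k+1). *)

Section gasket.
Variable R : realType.

Definition vertex (i : 'I_3) : R * R :=
  match val i with
  | 0%N => (0, 0)
  | 1%N => (1, 0)
  | _ => (1 / 2, Num.sqrt 3 / 2)
  end.

Definition contraction (i : 'I_3) (x : R * R) : R * R :=
  ((x.1 + (vertex i).1) / 2, (x.2 + (vertex i).2) / 2).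

Definition expansion (i : 'I_3) (x : R * R) : R * R :=
  (2 * x.1 - (vertex i).1, 2 * x.2 - (vertex i).2).

Lemma contractionK i : cancel (contraction i) (expansion i).
Proof.
by move=> [x y]; rewrite /expansion /contraction /= ![2 * _]mulrC
  !mulfVK ?pnatr_eq0// !addrK.
Qed.

Lemma expansionK i : cancel (expansion i) (contraction i).
Proof.
by move=> [x y]; rewrite /expansion /contraction /= !subrK ![2 * _]mulrC
  !mulfK ?pnatr_eq0.
Qed.

(* F_1^k for an integer exponent k *)
Definition contraction1_exp (k : int) : R * R -> R * R :=
  match k with
  | Posz m => iter m (contraction ord0)
  | Negz m => iter m.+1 (expansion ord0)
  end.

Fixpoint contraction_word (w : nat -> 'I_3) (m : nat) : R * R -> R * R :=
  if m is m'.+1 then contraction_word w m' \o contraction (w m') else id.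

Fixpoint vertices (m : nat) : set (R * R) :=
  if m is m'.+1 then \bigcup_i contraction i @` vertices m' else range vertex.

Definition gasket0 : set (R * R) := closure (\bigcup_m vertices m).

Definition gasket : set (R * R) :=
  \bigcup_(m : nat)
    contraction1_exp (- m%:Z) @` (gasket0 `|` [set - x | x in gasket0]).

Lemma gasket_origin : (0, 0) \in gasket.
Proof.
rewrite inE; exists 0%N => //; exists (0, 0) => //; left.
by apply: subset_closure; exists 0%N => //; exists ord0.
Qed.

Definition gasket_space := set_type gasket.

HB.instance Definition _ := Topological.copy gasket_space (set_type gasket).
HB.instance Definition _ :=
  isPointed.Build gasket_space (exist _ (0, 0) gasket_origin).

(* A unit cell is 2^m times a cell of level m of gasket0, or the opposite of
   such a set. *)
Definition unit_cell (A : set (R * R)) : Prop :=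
  exists (m : nat) (w : nat -> 'I_3),
    let B := contraction1_exp (- m%:Z) @` (contraction_word w m @` gasket0) in
    A = B \/ A = [set - x | x in B].

(* A sequence (s, c) encodes the maps tau_i(x) = +- x + c_i, with sign - when
   s i = true. *)
Definition tau (s : int -> bool) (c : int -> R * R) (i : int) (x : R * R)
  : R * R := (if s i then - x else x) + c i.

Definition cell s c (i : int) : set (R * R) := tau s c i @` gasket0.

(* i |-> cell s c i enumerates the unit cells without repetition; in
   particular the cells are non-overlapping and their union is gasket. *)
Definition cell_numbering (s : int -> bool) (c : int -> R * R) : Prop :=
  [/\ forall x, tau s c 0 x = x,
      forall i, unit_cell (cell s c i),
      injective (cell s c)
    & forall A, unit_cell A -> exists i, A = cell s c i].

Definition subcell s c (i : int) (w : nat -> 'I_3) (m : nat) : set (R * R) :=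
  tau s c i @` (contraction_word w m @` gasket0).

Definition kusuoka_entries (i : 'I_3) : seq (seq R) :=
  match val i with
  | 0%N => [:: [:: 2; -1; -1]; [:: -1; 1; 0]; [:: -1; 0; 1]]
  | 1%N => [:: [:: 1; -1; 0]; [:: -1; 2; -1]; [:: 0; -1; 1]]
  | _ => [:: [:: 1; 0; -1]; [:: 0; 1; -1]; [:: -1; -1; 2]]
  end.

Definition kusuoka_mx (i : 'I_3) : 'M[R]_3 :=
  5^-1 *: \matrix_(j, k) (nth [::] (kusuoka_entries i) j)`_k.

Fixpoint kusuoka_word (w : nat -> 'I_3) (m : nat) : 'M[R]_3 :=
  if m is m'.+1 then kusuoka_mx (w m') *m kusuoka_word w m' else 1%:M.

End gasket.

Notation borel T := (g_sigma_algebraType (@open T)).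

(* The part of a subset of the plane lying in the gasket. *)
Definition trace_on_gasket (R : realType) (A : set (R * R))
  : set (gasket_space R) := [set x | A (val x)].

Section measures.
Variable R : realType.

Local Open Scope ereal_scope.

Implicit Types (s : int -> bool) (c : int -> R * R)
  (mu : {measure set (borel (gasket_space R)) -> \bar R}).

Definition is_uniform_measure s c mu : Prop :=
  forall i m w, mu (trace_on_gasket (subcell s c i w m)) = ((3 ^- m)%R)%:E.

Definition is_kusuoka_measure s c mu : Prop :=
  (forall i m w, (1 <= m)%N ->
    mu (trace_on_gasket (subcell s c i w m)) =
    (2^-1 * (5 / 3) ^+ m *
      \tr ((kusuoka_word R w m)^T *m kusuoka_word R w m))%R%:E) /\
  (forall i, mu (trace_on_gasket (cell s c i)) = 1).

Definition gasket_power (n : nat) :=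
  prod_topology (fun _ : 'I_n => gasket_space R).

Definition box n (A : 'I_n -> set (gasket_space R)) : set (gasket_power n) :=
  [set x | forall k, A k (x k)].

(* gasket_space is second countable, so the Borel sets of gasket_power n are
   generated by the measurable boxes. *)
Definition is_product_measure n mu
    (mun : {measure set (borel (gasket_power n)) -> \bar R}) : Prop :=
  forall A : 'I_n -> set (borel (gasket_space R)),
    (forall k, measurable (A k)) -> mun (box A) = \prod_(k < n) mu (A k).

(* gasket_power n is locally compact and separable metric, so regularity of a
   Borel measure which is finite on compact sets is automatic. *)
Definition radon_measure n
    (sigma : {measure set (borel (gasket_power n)) -> \bar R}) : Prop :=
  forall K : set (gasket_power n), compact K -> sigma K < +oo.

Definition dyadic_simplex s c n (m : int) (i : 'I_n -> int)
  : set (gasket_power n) :=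
  box (fun k => trace_on_gasket (contraction1_exp (- m) @` cell s c (i k))).

Definition is_dyadic_simplex s c n (S : set (gasket_power n)) : Prop :=
  exists (m : int) (i : 'I_n -> int), S = dyadic_simplex s c m i.

Definition euclidean_dist (x y : R * R) : R :=
  Num.sqrt ((x.1 - y.1) ^+ 2 + (x.2 - y.2) ^+ 2)%R.

Definition max_dist n (x y : gasket_power n) : R :=
  \big[Num.max/0%R]_(k < n) euclidean_dist (val (x k)) (val (y k)).

Definition diam n (S : set (gasket_power n)) : \bar R :=
  ereal_sup [set (max_dist p.1 p.2)%:E | p in S `*` S].

(* In the two conditions dlo and dup are the lower and upper constants; the
   library's inverse satisfies (+oo)^-1 = 0. *)

Definition condition_M s c n
    (nun sigma : {measure set (borel (gasket_power n)) -> \bar R})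
    (dlo dup : \bar R) : Prop :=
  [/\ radon_measure sigma, 0 < dlo, dlo <= dup, 1 <= dup &
    exists C : R, (0 < C)%R /\
      forall S, is_dyadic_simplex s c S ->
        (0 < diam S <= 1 ->
           sigma S <= C%:E * nun S `^ fine dup^-1) /\
        (1 < diam S ->
           sigma S <= C%:E * nun S `^ fine dlo^-1)].

Definition condition_M' s c n
    (nun sigma : {measure set (borel (gasket_power n)) -> \bar R})
    (dlo dup : \bar R) : Prop :=
  [/\ radon_measure sigma, 0 < dlo, dlo <= dup, dlo <= 1 &
    exists C : R, (0 < C)%R /\
      forall S, is_dyadic_simplex s c S ->
        (0 < diam S <= 1 ->
           C^-1%:E * nun S `^ fine dlo^-1 <= sigma S) /\
        (1 < diam S ->
           C^-1%:E * nun S `^ fine dup^-1 <= sigma S)].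

End measures.

Definition spectral_dim (R : realType) : R := 2 * ln 3 / ln 5.

Definition delta_s (R : realType) : R := 1 / (2 / spectral_dim R - 1).

(* Main.v *)
Require Import Defs.
From mathcomp Require Import all_boot all_order all_algebra.
From mathcomp Require Import all_classical all_reals all_analysis.
From mathcomp Require Import ring lra zify.
Import Order.TTheory GRing.Theory Num.Theory.
Import numFieldNormedType.Exports.
Local Open Scope classical_set_scope.
Local Open Scope ring_scope.

(* Since both measures are products, everything reduces to the cells
   F_1^(-m)(S_j) of the gasket itself.  A cell with m >= 0 consists of 3^m unit
   cells that overlap in finitely many points; points are null, so nu and mu
   both give it mass 3^m.  For m = -k the cell is some tau_i F_w(S_0) with
   |w| = k, of nu-mass 3^(-k).  On the plane orthogonal to the constants the
   matrices 5 Y_i have norm 3 and determinant 3, so its mu-mass lies between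
   5^(-k) (arithmetic-geometric inequality: squared Hilbert-Schmidt norm at
   least twice the determinant) and (3/5)^k.  The upper rate is attained by
   the words 11...1, and the lower one by the words (123)^l, because
   Y_3 Y_2 Y_1 is elliptic. *)

(* MathComp-Analysis has an unrelated [contraction]. *)
Local Notation contraction := Defs.contraction.

(** * Affine coordinates, the enclosing triangle, self-similarity of the gasket *)

Section Geometry.
Context {R : realType}.
Implicit Types (x y t : R * R) (i j : 'I_3) (w u v : seq 'I_3) (b : bool).

(** The masses are prescribed only on the sets tau_i F_w(S_0) of an arbitrary numbering, while
    dyadic simplexes arise by scaling about the origin. Both are brought to the form ± 2^N F_w(S_0):
    F_1 is the homothety of ratio 1/2 about p_1 = 0, so expanding raises N and contracting prepends
    letters 1 to w. The first N letters of w then name a unit cell and the others a subcell of it.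
    For this the numbering must yield the map tau_i and not merely its image, which is a rigidity
    property of the gasket. Only F_1 contracts, yet every word occurs: for |v| = k, applying F_1^k
    to the unit cell 2^k F_v(S_0) gives 2^k F_w(S_0) with w = 1...1 v, and dropping the first k
    letters of w leaves v. This makes the extremal words available to dyadic simplexes; in the
    product the same cell is taken in every coordinate. Each converse compares two geometric
    sequences up to fixed constants. Only their ratios matter, and these are powers of 3 whose
    exponents give the bounds. *)

Lemma contractionE i x : contraction i x = 2^-1 *: (x + vertex R i).
Proof. by rewrite /contraction ![_ / 2]mulrC. Qed.

Lemma vertex0 : vertex R ord0 = 0. Proof. by []. Qed.

Lemma contraction1_expE (k : int) x : contraction1_exp k x = (2 ^ (- k)) *: x.
Proof.
case: k => k; rewrite /contraction1_exp.
  elim: k => [|k IH]; first by rewrite oppr0 expr0z scale1r.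
  by rewrite iterS IH contractionE vertex0 addr0 scalerA -exprz_inv
    -exprSz exprz_inv.
rewrite NegzE opprK; elim: k.+1 => [|m IH]; first by rewrite expr0z scale1r.
rewrite iterS IH /expansion vertex0 !subr0.
by rewrite exprSz -scalerA.
Qed.

Fixpoint word_map w x : R * R :=
  if w is i :: w' then contraction i (word_map w' x) else x.

Lemma word_map_cat u v x : word_map (u ++ v) x = word_map u (word_map v x).
Proof. by elim: u => //= i u ->. Qed.

Lemma word_map_rcons u i x :
  word_map (rcons u i) x = word_map u (contraction i x).
Proof. by rewrite -cats1 word_map_cat. Qed.

Lemma contraction_wordE (w : nat -> 'I_3) (m : nat) x :
  contraction_word w m x = word_map (mkseq w m) x.
Proof.
by elim: m x => // m IH x; rewrite mkseqS word_map_rcons -IH.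
Qed.

Lemma word_map_affine w x : word_map w x = 2^-1 ^+ size w *: x + word_map w 0.
Proof.
elim: w => [|i w IH] /=; first by rewrite expr0 scale1r addr0.
by rewrite !contractionE IH -addrA scalerDr scalerA exprS.
Qed.

Lemma word_map_nseq0 n x : word_map (nseq n ord0) x = 2^-1 ^+ n *: x.
Proof.
elim: n => [|n IH] /=; first by rewrite expr0 scale1r.
by rewrite contractionE IH vertex0 addr0 scalerA exprS.
Qed.

(* Affine coordinates in which the three vertices are (0,0), (1,0), (0,1). *)
Definition bary1 x : R := x.1 - x.2 / Num.sqrt 3.
Definition bary2 x : R := 2 * x.2 / Num.sqrt 3.
Arguments bary1 : simpl never.
Arguments bary2 : simpl never.

Lemma sqrt3_neq0 : Num.sqrt 3 != 0 :> R.
Proof. by rewrite sqrtr_eq0 -ltNge. Qed.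

Lemma baryD x y :
  (bary1 (x + y) = bary1 x + bary1 y) * (bary2 (x + y) = bary2 x + bary2 y).
Proof. by rewrite /bary1 /bary2 /=; split; ring. Qed.

Lemma baryZ a x :
  (bary1 (a *: x) = a * bary1 x) * (bary2 (a *: x) = a * bary2 x).
Proof. by rewrite /bary1 /bary2 /= /GRing.scale /=; split; ring. Qed.

Lemma baryN x : (bary1 (- x) = - bary1 x) * (bary2 (- x) = - bary2 x).
Proof. by rewrite /bary1 /bary2 /=; split; ring. Qed.

Lemma bary_inj x y : bary1 x = bary1 y -> bary2 x = bary2 y -> x = y.
Proof.
case: x y => [x1 x2] [y1 y2] /= e1 e2.
have r0 := sqrt3_neq0.
have e : x2 = y2.
  have -> : x2 = (2 * x2 / Num.sqrt 3) * Num.sqrt 3 / 2 by field.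
  by rewrite [2 * x2 / _]e2 /bary2 /=; field.
by congr pair => //; move: e1; rewrite /bary1 /= e; apply: addIr.
Qed.

Lemma bary_vertex i :
  (bary1 (vertex R i) = (val i == 1%N)%:R) *
  (bary2 (vertex R i) = (val i == 2%N)%:R).
Proof.
have r0 := sqrt3_neq0.
by case: i => -[|[|[|//]]] /= p; rewrite /bary1 /bary2 /vertex /=; split;
  field.
Qed.

(** The edge vectors p_2 - p_1 and p_3 - p_1 have length 1 and inner product 1/2, whence the form
    a^2 + ab + b^2. *)
Lemma sqr_dist_bary x y : (x.1 - y.1) ^+ 2 + (x.2 - y.2) ^+ 2 =
  (bary1 x - bary1 y) ^+ 2 + (bary1 x - bary1 y) * (bary2 x - bary2 y) +
  (bary2 x - bary2 y) ^+ 2.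
Proof.
have r0 := sqrt3_neq0.
have r3 : Num.sqrt 3 ^+ 2 = 3 :> R by rewrite sqr_sqrtr.
rewrite /bary1 /bary2; set r := Num.sqrt 3 in r0 r3 *.
transitivity ((x.1 - y.1) ^+ 2 + r ^+ 2 * ((x.2 - y.2) / r) ^+ 2).
  by field.
by rewrite r3; field.
Qed.

(** The convex hull of the vertices. Diameters, overlaps and the rigidity of cells are read off from
    it, as linear or quadratic inequalities in the two coordinates. *)
Definition triangle x : Prop :=
  [/\ 0 <= bary1 x, 0 <= bary2 x & bary1 x + bary2 x <= 1].

Lemma triangle_contraction i x : triangle x -> triangle (contraction i x).
Proof.
rewrite /triangle contractionE !baryZ !baryD !bary_vertex.
by case: i => -[|[|[|//]]] /= p [h1 h2 h3]; split; lra.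
Qed.

Lemma triangle_vertex i : triangle (vertex R i).
Proof.
rewrite /triangle !bary_vertex.
by case: i => -[|[|[|//]]] /= p; split; lra.
Qed.

Lemma triangle_dist x y : triangle x -> triangle y -> euclidean_dist x y <= 1.
Proof.
move=> [x1 x2 x3] [y1 y2 y3].
rewrite /euclidean_dist -[leRHS]sqrtr1 ler_wsqrtr// sqr_dist_bary.
move: (bary1 x) (bary2 x) (bary1 y) (bary2 y) x1 x2 x3 y1 y2 y3 => a b c d.
move=> x1 x2 x3 y1 y2 y3.
(* For differences of equal sign the form is at most the square of their sum; for opposite signs it
   is at most the larger of their squares. *)
have [h|h] := leP 0 (a - c); have [k|k] := leP 0 (b - d); nra.
Qed.

Lemma triangle_contraction_meet i j x y : i != j -> triangle x -> triangle y ->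
  contraction i x = contraction j y ->
  contraction i x = 2^-1 *: (vertex R i + vertex R j).
Proof.
move=> ij [x1 x2 x3] [y1 y2 y3] e.
have := congr1 bary1 e; have := congr1 bary2 e => {e}.
rewrite !contractionE !baryZ !baryD !bary_vertex => e2 e1.
apply: bary_inj; rewrite !baryZ !baryD !bary_vertex.
all: move: (bary1 x) (bary2 x) (bary1 y) (bary2 y) x1 x2 x3 y1 y2 y3 e1 e2.
all: case: i ij => -[|[|[|//]]] p; case: j => -[|[|[|//]]] p' //= _ *; lra.
Qed.

Lemma continuous_contraction i : continuous (contraction (R := R) i).
Proof.
have -> : contraction (R := R) i = fun x => 2^-1 *: (x + vertex R i).
  by apply: funext => x; rewrite contractionE.
move=> x; apply: cvgZr; apply: cvgD; [exact: cvg_id|exact: cvg_cst].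
Qed.

Lemma continuous_expansion i : continuous (expansion (R := R) i).
Proof.
have -> : expansion (R := R) i = fun x => 2 *: x - vertex R i by [].
move=> x; apply: cvgD; last exact: cvg_cst.
by apply: cvgZr; exact: cvg_id.
Qed.

Lemma continuous_bary1 : continuous bary1.
Proof.
move=> x; apply: cvgB; first exact: cvg_fst.
by apply: cvgM; [exact: cvg_snd|exact: cvg_cst].
Qed.

Lemma continuous_bary2 : continuous bary2.
Proof.
move=> x; apply: cvgM; last exact: cvg_cst.
by apply: cvgM; [exact: cvg_cst|exact: cvg_snd].
Qed.

Lemma closed_triangle : closed triangle.
Proof.
have -> : triangle = bary1 @^-1` [set a | 0 <= a] `&`
   bary2 @^-1` [set a | 0 <= a] `&`
   (fun x => bary1 x + bary2 x) @^-1` [set a | a <= 1].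
  by apply/seteqP; split=> x /= [] // [].
apply: closedI; first apply: closedI.
- by apply: closed_comp => [x _|]; [exact: continuous_bary1|exact: closed_ge].
- by apply: closed_comp => [x _|]; [exact: continuous_bary2|exact: closed_ge].
- apply: closed_comp => [x _|]; last exact: closed_le.
  by apply: cvgD; [exact: continuous_bary1|exact: continuous_bary2].
Qed.

Lemma vertices_triangle m : @vertices R m `<=` triangle.
Proof.
elim: m => [|m IH] /=; first by move=> _ [i _ <-]; exact: triangle_vertex.
by move=> _ [i _ [x hx <-]]; apply: triangle_contraction; apply: IH.
Qed.

Lemma gasket0_triangle : @gasket0 R `<=` triangle.
Proof.
rewrite /gasket0 (closure_id triangle).1; last exact: closed_triangle.
by apply: closureS => x [m _]; apply: vertices_triangle.
Qed.

Lemma closed_gasket0 : closed (@gasket0 R).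
Proof. exact: closed_closure. Qed.

Lemma gasket0_vertex i : @gasket0 R (vertex R i).
Proof. by apply: subset_closure; exists 0%N => //; exists i. Qed.

Lemma gasket0_contraction i x : @gasket0 R x -> @gasket0 R (contraction i x).
Proof.
move=> hx; suff : @gasket0 R `<=` contraction i @^-1` @gasket0 R by apply.
rewrite {1}/gasket0 (closure_id (contraction i @^-1` @gasket0 R)).1.
  apply: closureS => y [m _ hy]; apply: subset_closure; exists m.+1 => //.
  by exists i => //; exists y.
apply: closed_comp; last exact: closed_gasket0.
by move=> y _; exact: continuous_contraction.
Qed.

Lemma gasket0_word w x : @gasket0 R x -> @gasket0 R (word_map w x).
Proof. by move=> hx; elim: w => //= i w IH; exact: gasket0_contraction. Qed.

Lemma gasket0_self_similar x : @gasket0 R x ->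
  exists i, exists2 y, @gasket0 R y & x = contraction i y.
Proof.
(* [A i] is the image of the gasket under the i-th contraction, written as a preimage so that
   continuity of the inverse makes it closed. *)
pose A i := expansion i @^-1` @gasket0 R.
have clA i : closed (A i).
  apply: closed_comp; last exact: closed_gasket0.
  by move=> y _; exact: continuous_expansion.
have clU : closed (\bigcup_(i in [set: 'I_3]) A i).
  by apply: closed_bigcup => //; exact: finite_finset.
suff : @gasket0 R `<=` \bigcup_(i in [set: 'I_3]) A i.
  move=> h /h[i _ hy]; exists i; exists (expansion i x) => //.
  by rewrite expansionK.
rewrite {1}/gasket0 (closure_id (\bigcup_(i in [set: 'I_3]) A i)).1//.
apply: closureS => y [[|m] _] /=.
  (* Level 0: each vertex is the fixed point of its own contraction. *)
  move=> [i _ <-]; exists i => //; rewrite /A /= /expansion.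
  have -> : (2 * (vertex R i).1 - (vertex R i).1,
      2 * (vertex R i).2 - (vertex R i).2) = vertex R i.
    by rewrite [RHS]surjective_pairing; congr pair; ring.
  exact: gasket0_vertex.
move=> [i _ [z hz <-]]; exists i => //; rewrite /A /= contractionK.
by apply: subset_closure; exists m.
Qed.

End Geometry.

(** * Signed and scaled copies of the gasket *)

Section Simplexes.
Context {R : realType}.
Implicit Types (x y t : R * R) (i j : 'I_3) (w u v : seq 'I_3) (b : bool).
Implicit Types (N k m : nat).

(** The image of [gasket0] is a unit cell if N = |w|, a subcell of generation |w| - N of a unit cell
    if N < |w|, and a union of 3^(N - |w|) unit cells if N > |w|. *)
Definition simplex_map b N w x : R * R :=
  (-1) ^+ b *: (2 ^+ N *: word_map w x).

Definition simplex b N w : set (R * R) := simplex_map b N w @` @gasket0 R.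

Lemma simplex_map_inj b N w : injective (simplex_map b N w).
Proof.
move=> x y /scalerI; rewrite signr_eq0 => /(_ isT) /scalerI.
rewrite expf_neq0// => /(_ isT); rewrite [LHS]word_map_affine.
rewrite [RHS]word_map_affine => /addIr /scalerI.
by rewrite expf_neq0 ?invr_neq0// => /(_ isT).
Qed.

Lemma simplex_map_rcons b N w i x :
  simplex_map b N (rcons w i) x = simplex_map b N w (contraction i x).
Proof. by rewrite /simplex_map word_map_rcons. Qed.

Lemma simplex_map_cat b N u v x :
  simplex_map b N (u ++ v) x = simplex_map b N u (word_map v x).
Proof. by rewrite /simplex_map word_map_cat. Qed.

Lemma simplex_rcons_sub b N w i : simplex b N (rcons w i) `<=` simplex b N w.
Proof.
move=> _ [x hx <-]; rewrite simplex_map_rcons; exists (contraction i x) => //.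
exact: gasket0_contraction.
Qed.

Lemma simplex_split b N w x : simplex b N w x ->
  exists i, simplex b N (rcons w i) x.
Proof.
move=> [y /gasket0_self_similar[i [z hz ->]] <-]; exists i; exists z => //.
by rewrite simplex_map_rcons.
Qed.

Lemma simplex_descend b N w k x : simplex b N w x ->
  exists2 v, size v = k & simplex b N (w ++ v) x.
Proof.
move=> h; elim: k => [|k [v vk /simplex_split[i hi]]].
  by exists [::] => //; rewrite cats0.
by exists (rcons v i); [rewrite size_rcons vk|rewrite -rcons_cat].
Qed.

Lemma simplex_meet b N w i j : i != j ->
  simplex b N (rcons w i) `&` simplex b N (rcons w j) `<=`
  [set simplex_map b N w (2^-1 *: (vertex R i + vertex R j))].
Proof.
move=> ij _ [[y hy <-] [z hz]]; rewrite !simplex_map_rcons.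
move=> /simplex_map_inj e; congr simplex_map.
exact: (triangle_contraction_meet _ _ _ z ij (gasket0_triangle _ hy)
  (gasket0_triangle _ hz)).
Qed.

Lemma closed_simplex b N w : closed (simplex b N w).
Proof.
pose g x := 2 ^+ size w *: (2^-1 ^+ N *: ((-1) ^+ b *: x) - word_map w 0).
have sK x : (-1) ^+ b *: ((-1) ^+ b *: x) = x.
  by rewrite scalerA -signr_addb addbb scale1r.
have dK k x : 2^-1 ^+ k *: (2 ^+ k *: x) = x.
  by rewrite scalerA -exprMn mulVf// expr1n scale1r.
have hK k x : 2 ^+ k *: (2^-1 ^+ k *: x) = x.
  by rewrite scalerA -exprMn mulfV// expr1n scale1r.
have gK : cancel (simplex_map b N w) g.
  by move=> x; rewrite /g /simplex_map sK dK word_map_affine addrK hK.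
have Kg : cancel g (simplex_map b N w).
  by move=> x; rewrite /g /simplex_map word_map_affine dK subrK hK sK.
have -> : simplex b N w = g @^-1` @gasket0 R.
  apply/seteqP; split => [_ [x hx <-]|x hx]; first by rewrite /= gK.
  by exists (g x).
apply: closed_comp; last exact: closed_gasket0.
move=> x _; apply: cvgZr; apply: cvgD; last exact: cvg_cst.
by do 2 apply: cvgZr; exact: cvg_id.
Qed.

End Simplexes.

(** * Unit cells, their numbering, bounded regions of the gasket *)

Section Cells.
Context {R : realType}.
Implicit Types (x y t : R * R) (i j : 'I_3) (w u v : seq 'I_3) (b : bool).
Implicit Types (N k m : nat).

Lemma gasketP x : gasket x <-> exists b N, simplex b N [::] x.
Proof.
split=> [[m _ [y [hy|[z hz <-]] <-]]|[b [N [y hy <-]]]].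
- exists false, m; exists y => //.
  by rewrite /simplex_map expr0 scale1r contraction1_expE opprK.
- exists true, m; exists z => //.
  by rewrite /simplex_map expr1 scaleN1r contraction1_expE opprK scalerN.
- exists N => //; rewrite /simplex_map; case: b.
    exists (- y); first by right; exists y.
    by rewrite expr1 scaleN1r contraction1_expE opprK scalerN.
  exists y; first by left.
  by rewrite expr0 scale1r contraction1_expE opprK.
Qed.

Lemma simplex_gasket b N w : simplex b N w `<=` @gasket R.
Proof.
move=> x [y hy <-]; apply/gasketP; exists b, N.
by exists (word_map w y) => //; exact: gasket0_word.
Qed.

Lemma simplex_scale (m : int) b N w N' w' :
  (forall x, 2 ^ m *: (2 ^+ N *: word_map w x) =
    2 ^+ N' *: word_map w' x :> R * R) ->
  contraction1_exp (- m) @` @simplex R b N w = simplex b N' w'.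
Proof.
move=> e; rewrite image_comp; apply: eq_imagel => x _ /=.
by rewrite contraction1_expE opprK /simplex_map scalerA mulrC -scalerA e.
Qed.

Lemma simplex_expand b N w k :
  contraction1_exp (- k%:Z) @` @simplex R b N w = simplex b (N + k) w.
Proof.
apply: simplex_scale => x.
by rewrite scalerA exprD mulrC -exprnP.
Qed.

Lemma simplex_contract b N w k :
  contraction1_exp k%:Z @` @simplex R b N w = simplex b N (nseq k ord0 ++ w).
Proof.
rewrite -[k%:Z]opprK; apply: simplex_scale => x.
rewrite word_map_cat word_map_nseq0 !scalerA mulrC; congr (_ * _ *: _).
by rewrite -exprz_inv -exprnP.
Qed.

Lemma unit_cellP (A : set (R * R)) :
  unit_cell A <-> exists b u, A = simplex b (size u) u.
Proof.
have E (w : nat -> 'I_3) m : contraction1_exp (- m%:Z) @`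
    (contraction_word w m @` @gasket0 R) = simplex false m (mkseq w m).
  rewrite image_comp; apply: eq_imagel => x _ /=.
  by rewrite contraction1_expE opprK /simplex_map expr0 scale1r
    contraction_wordE.
have EN N w : [set - x | x in simplex false N w] = @simplex R true N w.
  rewrite image_comp; apply: eq_imagel => x _ /=.
  by rewrite /simplex_map expr0 expr1 scale1r scaleN1r.
split=> [[m [w]] /= []|[b [u ->]]].
- by rewrite E => ->; exists false, (mkseq w m); rewrite size_mkseq.
- by rewrite E EN => ->; exists true, (mkseq w m); rewrite size_mkseq.
- exists (size u), (nth ord0 u) => /=; rewrite E EN mkseq_nth.
  by case: b; [right|left].
Qed.

Definition signed_translate b t x : R * R := (if b then - x else x) + t.

Lemma simplex_map_unit b u :
  exists t, forall x, simplex_map b (size u) u x = signed_translate b t x.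
Proof.
exists ((-1) ^+ b *: (2 ^+ size u *: word_map u 0)) => x.
rewrite /simplex_map word_map_affine 2!scalerDr; congr (_ + _).
rewrite [_ *: (_ *: x)]scalerA -exprMn mulfV// expr1n scale1r.
by case: b; rewrite ?expr0 ?expr1 ?scale1r ?scaleN1r.
Qed.

(* If a translate of the gasket equals a translate of its opposite, then some d
   is such that d - p_1, d - p_2 and d - p_3 all lie in the triangle, which
   forces d = p_2 = p_3. *)
Lemma signed_translate_inj b t b' t' :
  signed_translate b t @` @gasket0 R `<=` signed_translate b' t' @` @gasket0 R ->
  signed_translate b' t' @` @gasket0 R `<=` signed_translate b t @` @gasket0 R ->
  b = b' /\ t = t'.
Proof.
move=> h h'.
have H (c c' : bool) (a a' : R * R) :
    signed_translate c a @` @gasket0 R `<=` signed_translate c' a' @` @gasket0 R ->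
    forall i, exists2 z, triangle z & signed_translate c a (vertex R i) =
      signed_translate c' a' z.
  move=> k i; have [z hz e] := k _ (ex_intro2 _ _ _ (gasket0_vertex i) erefl).
  by exists z; [exact: gasket0_triangle|rewrite e].
have {}h := H _ _ _ _ h; have {}h' := H _ _ _ _ h'.
have B c a x : bary1 (signed_translate c a x) = (-1) ^+ c * bary1 x + bary1 a /\
    bary2 (signed_translate c a x) = (-1) ^+ c * bary2 x + bary2 a.
  rewrite /signed_translate !baryD; case: c => /=.
    by rewrite !baryN expr1 !mulN1r.
  by rewrite expr0 !mul1r.
have C (c c' : bool) (a a' : R * R) i z :
    signed_translate c a (vertex R i) = signed_translate c' a' z ->
    (-1) ^+ c * (val i == 1%N)%:R + bary1 a = (-1) ^+ c' * bary1 z + bary1 a' /\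
    (-1) ^+ c * (val i == 2%N)%:R + bary2 a = (-1) ^+ c' * bary2 z + bary2 a'.
  by move=> e; rewrite -(B c' a' z).1 -(B c' a' z).2 -e (B _ _ _).1 (B _ _ _).2
    !bary_vertex.
have [z0 [p1 p2 p3] /C[/= e1 e2]] := h ord0.
have [z1 [q1 q2 q3] /C[/= f1 f2]] := h (inord 1).
have [z2 [r1 r2 r3] /C[/= g1 g2]] := h (inord 2).
have [z3 [s1 s2 s3] /C[/= k1 k2]] := h' ord0.
rewrite !inordK// in f1 f2 g1 g2.
have bb : b = b'.
  by move: e1 e2 f1 f2 g1 g2 k1 k2; case: b b' {h h' H C} => -[] //=;
    rewrite ?expr0 ?expr1 => *; exfalso; lra.
(* With equal signs, [z0] and [z3] are opposite vectors, equal up to sign to t - t' and t' - t. Both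
   lie in the triangle, so they vanish. *)
split=> //; apply: bary_inj; move: e1 e2 f1 f2 g1 g2 k1 k2; rewrite -bb;
  case: b {h h' bb C H}; rewrite ?expr0 ?expr1 /= => *; lra.
Qed.

Section Numbering.
Variables (s : int -> bool) (c : int -> R * R) (sc : cell_numbering s c).

(** The numbering lists cells as sets, but subcells are images under the map [tau s c j]. Rigidity
    turns equality of sets into equality of maps, so both descriptions subdivide a cell by the same
    words. *)
Lemma cell_unit b u :
  exists j : int, forall x, tau s c j x = simplex_map b (size u) u x.
Proof.
case: sc => _ _ _ H; have [t ht] := simplex_map_unit b u.
have [|j ej] := H (simplex b (size u) u); first by apply/unit_cellP; exists b, u.
have e1 : simplex b (size u) u = signed_translate b t @` @gasket0 R.
  by apply: eq_imagel => x _; rewrite ht.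
have e2 : cell s c j = signed_translate (s j) (c j) @` @gasket0 R by [].
have [eb et] : b = s j /\ t = c j.
  by apply: signed_translate_inj; rewrite -e1 -e2 ej.
by exists j => x; rewrite ht eb et.
Qed.

Lemma cell_simplex (j : int) : exists b u, cell s c j = simplex b (size u) u.
Proof. by case: sc => _ + _ _ => /(_ j) /unit_cellP. Qed.

Lemma subcell_simplex b N w : (N <= size w)%N ->
  exists j : int, simplex b N w = subcell s c j (nth ord0 (drop N w)) (size w - N).
Proof.
move=> Nw; have [j hj] := cell_unit b (take N w); exists j.
rewrite /subcell image_comp; apply: eq_imagel => x _ /=.
rewrite hj contraction_wordE -size_drop mkseq_nth size_takel//.
by rewrite -simplex_map_cat cat_take_drop.
Qed.

End Numbering.

(** The function [bary1 + bary2] vanishes at the origin and is at least 1/2 on the cells F_2(S_0)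
    and F_3(S_0). A point of a large simplex where it is small therefore lies in the subcell at the
    origin, and the scale can be lowered step by step to m. *)
Lemma gasket_bounded_simplex x m : gasket x ->
  `|bary1 x + bary2 x| < 2 ^+ m -> exists b, simplex b m [::] x.
Proof.
move=> /gasketP[b [N [y hy <-]]]; exists b.
suff [z hz e] : exists2 z, @gasket0 R z & 2 ^+ N *: y = 2 ^+ m *: z.
  by exists z => //; rewrite /simplex_map /= e.
move: H; rewrite /simplex_map !baryZ -!mulrDr !normrM normr_sign mul1r.
rewrite ger0_norm ?exprn_ge0// => H.
elim: N y hy H => [|N IH] y hy H.
  exists (word_map (nseq m ord0) y); first exact: gasket0_word.
  rewrite expr0 scale1r word_map_nseq0 scalerA -exprMn mulfV// expr1n.
  by rewrite scale1r.
have [Nm|mN] := leqP N.+1 m.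
  exists (word_map (nseq (m - N.+1) ord0) y); first exact: gasket0_word.
  rewrite word_map_nseq0 scalerA -{1}(subnK Nm) exprD mulrAC -exprMn.
  by rewrite mulfV// expr1n mul1r.
have [i [z hz yz]] := gasket0_self_similar _ hy.
have [z1 z2 z3] := gasket0_triangle _ hz.
have i0 : i = ord0.
  apply/eqP/negPn/negP => i0.
  have : 2^-1 <= bary1 y + bary2 y.
    rewrite yz contractionE !baryZ !baryD !bary_vertex.
    case: i i0 {yz} => -[|[|[|//]]] p //= _; lra.
  have mN2 : 2 ^+ m <= 2 ^+ N :> R by rewrite ler_weXn2l// ler1n.
  move: H; rewrite exprS ltNge => /negP H h; apply: H.
  apply: (le_trans mN2); rewrite ger0_norm; last lra.
  have : 0 < 2 ^+ N :> R by rewrite exprn_gt0.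
  move: (2 ^+ N) => e e0; nra.
have yE : y = 2^-1 *: z by rewrite yz i0 contractionE vertex0 addr0.
have e2 : 2 ^+ N.+1 *: y = 2 ^+ N *: z.
  by rewrite yE exprSr -scalerA [2 *: _]scalerA mulfV// scale1r.
rewrite e2; apply: IH => //; move: H.
rewrite yE !baryZ -mulrDr normrM [`|2^-1|]ger0_norm ?invr_ge0//.
by rewrite exprSr mulrA mulfK.
Qed.

End Cells.

(** * The Kusuoka matrices on the plane orthogonal to the constants *)

Section KusuokaEnergy.
Context {R : realType}.
Implicit Types (z : R * R) (i j : 'I_3) (w : seq 'I_3) (k m : nat).

(* The matrix [5 Y_i] kills the constants, so it acts on the differences
   [(z_1 - z_3, z_2 - z_3)] of the entries of a column. *)
Definition kusuoka_step i z : R * R :=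
  match val i with
  | 0%N => (3 * z.1 - z.2, z.2)
  | 1%N => (z.1, 3 * z.2 - z.1)
  | _ => (2 * z.1 + z.2, z.1 + 2 * z.2)
  end.

Definition kusuoka_act w z := foldl (fun y i => kusuoka_step i y) z w.

Lemma kusuoka_act_rcons w i z :
  kusuoka_act (rcons w i) z = kusuoka_step i (kusuoka_act w z).
Proof. by rewrite /kusuoka_act foldl_rcons. Qed.

(** This is 3/2 times the squared norm of the vector of sum zero with differences z. *)
Definition kusuoka_form z : R := z.1 ^+ 2 - z.1 * z.2 + z.2 ^+ 2.

(** Half the squared Hilbert-Schmidt norm, on the plane orthogonal to the constants, of the product
    of the matrices 5 Y_i along w: the three pairs are the differences of the basis vectors. *)
Definition kusuoka_energy w : R :=
  (kusuoka_form (kusuoka_act w (1, 0)) + kusuoka_form (kusuoka_act w (0, 1)) +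
   kusuoka_form (kusuoka_act w (-1, -1))) / 3.

(** Columns are tracked by their differences only. The columns of each Y_i sum to 0, so after at
    least one letter a column is recovered from its differences. *)
Lemma kusuoka_word_differences (w : nat -> 'I_3) m (j : 'I_3) :
  let Y := kusuoka_word R w m in
  let i1 : 'I_3 := lift ord0 ord0 in let i2 : 'I_3 := lift ord0 (lift ord0 ord0) in
  let e : R * R := ((ord0 == j)%:R - (i2 == j)%:R, (i1 == j)%:R - (i2 == j)%:R) in
  [/\ Y ord0 j - Y i2 j = 5^-1 ^+ m * (kusuoka_act (mkseq w m) e).1,
      Y i1 j - Y i2 j = 5^-1 ^+ m * (kusuoka_act (mkseq w m) e).2
    & (0 < m)%N -> Y ord0 j + Y i1 j + Y i2 j = 0].
Proof.
move=> Y i1 i2 e; rewrite {}/Y; elim: m => [|m [IH1 IH2 _]].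
  by rewrite /= !mxE expr0 !mul1r; split.
rewrite mkseqS kusuoka_act_rcons exprS.
have E (i : 'I_3) : kusuoka_word R w m.+1 i j =
    kusuoka_mx R (w m) i ord0 * kusuoka_word R w m ord0 j +
    kusuoka_mx R (w m) i i1 * kusuoka_word R w m i1 j +
    kusuoka_mx R (w m) i i2 * kusuoka_word R w m i2 j.
  by rewrite /= mxE !big_ord_recl big_ord0 addr0 addrA.
rewrite !{}E !mxE.
move: (kusuoka_word R w m) IH1 IH2 => Z.
move: (kusuoka_act _ _) => [a b] /=.
set z0 := Z ord0 j; set z1 := Z i1 j; set z2 := Z i2 j.
move: (5^-1 ^+ m) => f IH1 IH2.
have -> : z0 = f * a + z2 by rewrite -IH1 subrK.
have -> : z1 = f * b + z2 by rewrite -IH2 subrK.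
rewrite /kusuoka_step; case: (w m) => -[|[|[|//]]] p /=; split; try move=> _;
  by field.
Qed.

(** The rate 1/15 is 5/3 times 1/25, the latter from the factors 1/5 in the matrices. At m = 0 the
    identity still sees the constants and the left-hand side would be 3/2 instead of 1. *)
Lemma kusuoka_trace (w : nat -> 'I_3) m : (1 <= m)%N ->
  2^-1 * (5 / 3) ^+ m *
    \tr ((kusuoka_word R w m)^T *m kusuoka_word R w m) =
  15^-1 ^+ m * kusuoka_energy (mkseq w m).
Proof.
move=> m1.
have F (Y0 Y1 Y2 f : R) z : Y0 - Y2 = f * z.1 -> Y1 - Y2 = f * z.2 ->
    Y0 + Y1 + Y2 = 0 ->
    Y0 * Y0 + (Y1 * Y1 + Y2 * Y2) = 2 / 3 * f ^+ 2 * kusuoka_form z.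
  move=> e1 e2 e3; rewrite /kusuoka_form.
  have {e3} Y0E : Y0 = - Y1 - Y2 by lra.
  transitivity (2 / 3 * ((f * z.1) ^+ 2 - (f * z.1) * (f * z.2) + (f * z.2) ^+ 2)).
    by rewrite -e1 -e2 Y0E; field.
  by ring.
have T j : ((kusuoka_word R w m)^T *m kusuoka_word R w m) j j =
    let e : R * R := ((ord0 == j)%:R - (lift ord0 (lift ord0 ord0) == j)%:R,
      (lift ord0 ord0 == j)%:R - (lift ord0 (lift ord0 ord0) == j)%:R) in
    2 / 3 * (5^-1 ^+ m) ^+ 2 * kusuoka_form (kusuoka_act (mkseq w m) e).
  have [e1 e2 /(_ m1) e3] := kusuoka_word_differences w m j.
  rewrite mxE !big_ord_recl big_ord0 addr0 !mxE.
  exact: F.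
rewrite /mxtrace !big_ord_recl big_ord0 addr0 !T /kusuoka_energy.
rewrite /= !subr0 !sub0r.
set A := kusuoka_form _; set B := kusuoka_form _; set C := kusuoka_form _.
have -> : 15^-1 ^+ m = (5 / 3) ^+ m * (5^-1 ^+ m) ^+ 2 :> R.
  by rewrite -exprM mulnC exprM -exprMn; congr (_ ^+ m); field.
move: (_ ^+ m) (_ ^+ m) => f g; by field.
Qed.

Lemma kusuoka_energy_nil : kusuoka_energy [::] = 1.
Proof. by rewrite /kusuoka_energy /kusuoka_form /=; field. Qed.

(** Each 5 Y_i is symmetric with eigenvalues 0, 1 and 3, so a letter multiplies squared norms by at
    most 9. *)
Lemma kusuoka_form_act w z :
  kusuoka_form (kusuoka_act w z) <= 9 ^+ size w * kusuoka_form z.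
Proof.
elim/last_ind: w => [|w i IH]; first by rewrite expr0 mul1r.
rewrite kusuoka_act_rcons size_rcons exprS -mulrA.
apply: (@le_trans _ _ (9 * kusuoka_form (kusuoka_act w z))).
  move: (kusuoka_act w z) => [a b]; rewrite /kusuoka_form /kusuoka_step.
  have h1 := sqr_ge0 (a - b); have h2 := sqr_ge0 a.
  have h3 := sqr_ge0 b.
  by case: i => -[|[|[|//]]] p /=; nra.
by rewrite ler_pM2l.
Qed.

Lemma kusuoka_energy_le w : kusuoka_energy w <= 9 ^+ size w.
Proof.
have := kusuoka_form_act w (1, 0); have := kusuoka_form_act w (0, 1).
have := kusuoka_form_act w (-1, -1); rewrite /kusuoka_energy.
rewrite {2 4 6}/kusuoka_form /= => h1 h2 h3; lra.
Qed.

Lemma kusuoka_act_det w z z' :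
  (kusuoka_act w z).1 * (kusuoka_act w z').2 -
  (kusuoka_act w z).2 * (kusuoka_act w z').1 =
  3 ^+ size w * (z.1 * z'.2 - z.2 * z'.1).
Proof.
elim/last_ind: w => [|w i IH]; first by rewrite expr0 mul1r.
rewrite !kusuoka_act_rcons size_rcons exprS -mulrA -IH.
move: (kusuoka_act w z) (kusuoka_act w z') => [a b] [c d].
by rewrite /kusuoka_step; case: i => -[|[|[|//]]] p /=; ring.
Qed.

Lemma kusuoka_act_sum w : kusuoka_act w (-1, -1) =
  - (kusuoka_act w (1, 0) + kusuoka_act w (0, 1)).
Proof.
elim/last_ind: w => [|w i IH]; first by rewrite /=; congr pair => /=; ring.
rewrite !kusuoka_act_rcons IH.
move: (kusuoka_act w (1, 0)) (kusuoka_act w (0, 1)) => [a b] [c d].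
by rewrite /kusuoka_step; case: i => -[|[|[|//]]] p /=; congr pair => /=; ring.
Qed.

Lemma kusuoka_energy_ge w : 3 ^+ size w <= kusuoka_energy w.
Proof.
have := kusuoka_act_det w (1, 0) (0, 1).
rewrite /kusuoka_energy kusuoka_act_sum.
move: (kusuoka_act w (1, 0)) (kusuoka_act w (0, 1)) => [a b] [c d] /=.
rewrite mul1r mul0r subr0 mulr1 /kusuoka_form /= => <-.
(* These three squares add up exactly to 3 times the energy minus 3 times the determinant. *)
have h1 := sqr_ge0 (a + c - d); have h2 := sqr_ge0 (a - b - d).
have h3 := sqr_ge0 (b + c); lra.
Qed.

Lemma kusuoka_energy_ge0 w : 0 <= kusuoka_energy w.
Proof. by apply: le_trans (kusuoka_energy_ge w); rewrite exprn_ge0. Qed.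

(** The pair (1, 0) is an eigenvector of [kusuoka_step ord0] for the top eigenvalue 3. The other two
    terms are only bounded below by 0, hence the factor 1/3. *)
Lemma kusuoka_energy_nseq0 m : 9 ^+ m / 3 <= kusuoka_energy (nseq m ord0).
Proof.
have -> : kusuoka_energy (nseq m ord0) = (9 ^+ m +
    kusuoka_form (kusuoka_act (nseq m ord0) (0, 1)) +
    kusuoka_form (kusuoka_act (nseq m ord0) (-1, -1))) / 3.
  rewrite /kusuoka_energy; congr ((_ + _ + _) / _).
  suff -> : kusuoka_act (nseq m ord0) (1, 0) = (3 ^+ m, 0).
    by rewrite /kusuoka_form /= mulr0 subr0 expr0n addr0 -exprM mulnC exprM;
      congr (_ ^+ _); ring.
  elim: m => [|m IH]; first by rewrite expr0.
  have -> : nseq m.+1 (ord0 : 'I_3) = rcons (nseq m ord0) ord0.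
    by rewrite -cats1 -(nseqD m 1) addn1.
  by rewrite kusuoka_act_rcons IH /kusuoka_step /= subr0 exprS.
have P z : 0 <= kusuoka_form z.
  have h1 := sqr_ge0 (z.1 - z.2 / 2); have h2 := sqr_ge0 z.2.
  by rewrite /kusuoka_form; nra.
have := P (kusuoka_act (nseq m ord0) (0, 1)).
have := P (kusuoka_act (nseq m ord0) (-1, -1)); lra.
Qed.

Definition cyclic_word k : seq 'I_3 := iter k (fun w => w ++ enum 'I_3) [::].

Lemma size_cyclic_word k : size (cyclic_word k) = (3 * k)%N.
Proof.
elim: k => // k IH.
by rewrite [cyclic_word _]/= size_cat IH size_enum_ord mulnS addnC.
Qed.

(* The matrix [Y_3 Y_2 Y_1] is elliptic, with invariant quadratic form
   [3 a^2 - 4 a b + 2 b^2], so its powers grow at the smallest possible rate. *)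
Lemma kusuoka_energy_cyclic k : kusuoka_energy (cyclic_word k) <= 4 * 27 ^+ k.
Proof.
(* Q(z) = - det(z, Mz), where M has rows (3, 2) and (-3, 7) and is the product of the three steps;
   thus Q(Mz) = det(M) Q(z) with det(M) = 27. The final constant is 4 = 2 (3 + 2 + 1) / 3, from the
   values of Q at the three initial pairs. *)
pose Q z : R := 3 * z.1 ^+ 2 - 4 * z.1 * z.2 + 2 * z.2 ^+ 2.
have QE z : Q (kusuoka_act (cyclic_word k) z) = 27 ^+ k * Q z.
  elim: k => [|k IH]; first by rewrite expr0 mul1r.
  have E l : kusuoka_act (cyclic_word l.+1) z =
      kusuoka_act (enum 'I_3) (kusuoka_act (cyclic_word l) z).
    by rewrite /kusuoka_act -foldl_cat.
  rewrite E exprS -mulrA -IH; move: (kusuoka_act _ z) => [a b].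
  rewrite !enum_ordSl (size0nil (size_enum_ord 0)) /Q /kusuoka_act /=.
  by rewrite /kusuoka_step /=; ring.
have P z : kusuoka_form z <= 2 * Q z.
  have h1 := sqr_ge0 (z.1 - 7 / 10 * z.2); have h2 := sqr_ge0 z.2.
  by rewrite /kusuoka_form /Q; nra.
rewrite /kusuoka_energy.
have := P (kusuoka_act (cyclic_word k) (1, 0)).
have := P (kusuoka_act (cyclic_word k) (0, 1)).
have := P (kusuoka_act (cyclic_word k) (-1, -1)).
rewrite !QE /Q /= => h1 h2 h3; lra.
Qed.

End KusuokaEnergy.

(** Constants do not affect the comparison of ratios: if x > y then (x/y)^k grows at least linearly
    by Bernoulli's inequality. *)
Lemma geometric_le {R : realType} (a C x y : R) : 0 < a -> 0 < y ->
  (forall k, a * x ^+ k <= C * y ^+ k) -> x <= y.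
Proof.
move=> a0 y0 H; rewrite leNgt; apply/negP => yx.
have q0 : 0 < x / y - 1 by rewrite subr_gt0 ltr_pdivlMr// mul1r.
have bernoulli k : k%:R * (x / y - 1) <= (x / y) ^+ k.
  elim: k => [|k IH]; first by rewrite mul0r expr0.
  have : 1 <= (x / y) ^+ k by rewrite exprn_ege1// -subr_ge0 ltW.
  rewrite exprS -natr1; move: ((x / y) ^+ k) (k%:R) (x / y) q0 IH => p l q; nra.
have [k hk] : exists k : nat, C / (a * (x / y - 1)) < k%:R.
  by eexists; exact: truncnS_gt.
have := H k; rewrite -ler_pdivrMr ?exprn_gt0// -mulrA -expr_div_n leNgt.
rewrite ltr_pdivrMr ?mulr_gt0// in hk => /negP; apply.
rewrite (lt_le_trans hk)// mulrCA ler_wpM2l//; exact: ltW.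
Qed.

(** * Null points and masses of simplexes *)

Section GasketMeasure.
Context {R : realType}.
Implicit Types (x y t : R * R) (w u v : seq 'I_3) (b : bool).
Implicit Types (N k m : nat).

Lemma continuous_gasket_val : continuous (val : gasket_space R -> R * R).
Proof. exact: (@initial_continuous _ _ (val : gasket_space R -> R * R)). Qed.

Lemma closed_trace (A : set (R * R)) : closed A -> closed (trace_on_gasket A).
Proof.
by move=> cA; apply: preimage_closed => // x _; exact: continuous_gasket_val.
Qed.

Lemma measurable_generatorC (T : pointedType) (G : set (set T)) (A : set T) :
  G (~` A) -> measurable (A : set (g_sigma_algebraType G)).
Proof.
move=> GA; rewrite -[A]setCK; apply: measurableC.
exact: sub_sigma_algebra.
Qed.

Lemma measurable_trace (A : set (R * R)) : closed A ->
  measurable (trace_on_gasket A : set (borel (gasket_space R))).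
Proof.
by move=> cA; apply: measurable_generatorC; apply: closed_openC; exact: closed_trace.
Qed.

Lemma measurable_simplex b N w :
  measurable (trace_on_gasket (simplex b N w) : set (borel (gasket_space R))).
Proof. by apply: measurable_trace; exact: closed_simplex. Qed.

Lemma measurable_point x :
  measurable (trace_on_gasket [set x] : set (borel (gasket_space R))).
Proof.
apply: measurable_trace; apply: accessible_closed_set1.
by apply: hausdorff_accessible; exact: norm_hausdorff.
Qed.

Lemma hausdorff_gasket : hausdorff_space (gasket_space R).
Proof.
move=> p q cpq; apply: val_inj; apply: norm_hausdorff => A B hA hB.
have [z [zA zB]] := cpq _ _ (continuous_gasket_val p _ hA)
  (continuous_gasket_val q _ hB).
by exists (val z).
Qed.

Section SimplexMeasure.
Variable rho : {measure set (borel (gasket_space R)) -> \bar R}.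

Local Notation simplex_measure b N w :=
  (rho (trace_on_gasket (@simplex R b N w))).

(** These two hypotheses hold for nu and mu alike, so null points and large cells are treated once.
    The rate 3/5 is that of mu and dominates the rate 1/3 of nu. *)
Hypothesis unit_simplex : forall b u, simplex_measure b (size u) u = 1%E.
Hypothesis small_simplex : forall b N w, (N <= size w)%N ->
  (simplex_measure b N w <= ((3 / 5) ^+ (size w - N))%:E)%E.

Lemma point_null x : rho (trace_on_gasket [set x]) = 0%E.
Proof.
have [/gasketP[b [N xN]]|nx] := pselect (gasket x); last first.
  rewrite [X in rho X](_ : _ = set0) ?measure0//.
  by rewrite -subset0 => -[y hy] /= /esym yx; apply: nx; rewrite yx -inE.
have le k : (rho (trace_on_gasket [set x]) <= ((3 / 5) ^+ k)%:E)%E.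
  (* The first N letters lead down to a unit cell; only the next k make the mass decay. *)
  have [v sv hv] := simplex_descend _ _ _ (N + k) _ xN.
  apply: (@le_trans _ _ (simplex_measure b N v)).
    apply: le_measure; rewrite ?inE.
    - exact: measurable_point.
    - exact: measurable_simplex.
    - by move=> z; rewrite /trace_on_gasket /mkset => ->.
  by rewrite (le_trans (small_simplex _ _ _ _)) ?sv ?leq_addr// addKn.
apply/eqP; rewrite eq_le measure_ge0 andbT leNgt; apply/negP.
have := measure_ge0 rho (trace_on_gasket [set x]); move: le.
case: (rho _) => [r H _|/(_ 0%N)|] //=; rewrite lte_fin => r0.
suff : 1 <= 3 / 5 :> R by lra.
apply: (@geometric_le _ r 1) => // k.
by rewrite expr1n mulr1 mul1r -lee_fin.
Qed.

(** Induction from the unit cells upwards: three cells one level below meet pairwise in at most a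
    midpoint, which is null, so their masses add. *)
Lemma large_simplex b N w : (size w <= N)%N ->
  simplex_measure b N w = (3 ^+ (N - size w))%:E.
Proof.
move: {2}(N - size w)%N (erefl (N - size w)%N) => k; elim: k w => [|k IH] w e wN.
  have -> : N = size w by apply/eqP; rewrite eqn_leq wN andbT -subn_eq0 e.
  by rewrite subnn expr0 unit_simplex.
rewrite e.
have {}IH i : simplex_measure b N (rcons w i) = (3 ^+ k)%:E.
  by rewrite IH size_rcons; [congr ((_ ^+ _)%:E)|..]; lia.
pose A i := trace_on_gasket (@simplex R b N (rcons w i)) :
  set (borel (gasket_space R)).
have mA i : measurable (A i) by exact: measurable_simplex.
have null i j : i != j -> rho (A i `&` A j) = 0%E.
  move=> ij; apply: (@subset_measure0 _ _ _ rho _ _ _ _ _ (point_null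
    (simplex_map b N w (2^-1 *: (vertex R i + vertex R j))))).
  - exact: measurableI.
  - exact: measurable_point.
  - by move=> x; exact: simplex_meet.
pose i1 : 'I_3 := lift ord0 ord0; pose i2 : 'I_3 := lift ord0 (lift ord0 ord0).
have -> : trace_on_gasket (simplex b N w) = A ord0 `|` A i1 `|` A i2.
  apply/seteqP; split => x /=.
    move=> /simplex_split[i hi].
    have : (i == ord0) || (i == i1) || (i == i2).
      by case: i {hi} => -[|[|[|//]]].
    by move=> /orP[/orP[]|] /eqP ii; rewrite ii in hi; [left; left|left; right|right].
  by move=> [[]|] /simplex_rcons_sub.
have fin (B : set (borel (gasket_space R))) : rho B = 0%E -> (- rho B = 0)%E.
  by move=> ->; rewrite oppe0.
rewrite measureUfinr ?IH ?ltry//; last exact: measurableU.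
rewrite setIUl fin ?adde0; last first.
  by apply/eqP; rewrite eq_le measure_ge0 andbT -[leRHS]adde0
    -{1}(null ord0 i2)// -(null i1 i2)//; apply: measureU2; exact: measurableI.
rewrite measureUfinr ?IH ?ltry// fin ?null// adde0 -!EFinD exprS.
by congr EFin; ring.
Qed.

End SimplexMeasure.

Section ProductOfSimplexes.
Variables (s : int -> bool) (c : int -> R * R).
Hypothesis sc : cell_numbering s c.

Lemma uniform_simplex (nu : {measure set (borel (gasket_space R)) -> \bar R}) :
  is_uniform_measure s c nu -> forall b N w, (N <= size w)%N ->
  nu (trace_on_gasket (simplex b N w)) = (3^-1 ^+ (size w - N))%:E.
Proof.
move=> H b N w /(subcell_simplex _ _ sc b)[j ->].
by rewrite H exprVn.
Qed.

Lemma kusuoka_simplex (mu : {measure set (borel (gasket_space R)) -> \bar R}) :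
  is_kusuoka_measure s c mu -> forall b N w, (N <= size w)%N ->
  mu (trace_on_gasket (simplex b N w)) =
    (15^-1 ^+ (size w - N) * kusuoka_energy (drop N w))%:E.
Proof.
move=> [H1 H0] b N w Nw; have [j ->] := subcell_simplex _ _ sc b _ _ Nw.
(* The mass of an undivided unit cell is prescribed separately; it fits the same formula since the
   empty word has energy 1. *)
case: (posnP (size w - N)) => e; last first.
  by rewrite H1// kusuoka_trace// -size_drop mkseq_nth.
have d0 : drop N w = [::] by apply: size0nil; rewrite size_drop.
rewrite e d0 kusuoka_energy_nil expr0 mulr1 -(H0 j); congr (mu (trace_on_gasket _)).
by rewrite /subcell /cell image_id.
Qed.

End ProductOfSimplexes.
End GasketMeasure.

(** * Exponents expressed through powers of 3 *)

Section PowersOfThree.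
Context {R : realType}.

Lemma ler_powR_exponent (a x y : R) : 1 < a -> (a `^ x <= a `^ y) = (x <= y).
Proof.
move=> a1; have a0 : 0 < a by exact: lt_trans a1.
rewrite /powR gt_eqF// ler_expR ler_pM2r//.
by rewrite ln_gt0.
Qed.

Lemma powRXn (a x : R) k : 0 <= a -> (a ^+ k) `^ x = (a `^ x) ^+ k.
Proof. move=> a0.
by rewrite -(powR_mulrn k a0) -(powR_mulrn k (powR_ge0 a x)) powRAC. Qed.

Lemma powR_third (x : R) : 3^-1 `^ x = 3 `^ (- x).
Proof. by rewrite -powR_inv1// -powRrM mulN1r. Qed.

Lemma inv_delta_sE : 1 / delta_s R = (ln 5 - ln 3) / ln 3.
Proof.
have l3 : ln 3 != 0 :> R by rewrite gt_eqF// ln_gt0// ltr1n.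
have l5 : ln 5 != 0 :> R by rewrite gt_eqF// ln_gt0// ltr1n.
by rewrite /delta_s /spectral_dim !div1r invrK; field; rewrite l3 l5.
Qed.

Lemma powR_inv_delta_s : 3 `^ (1 / delta_s R) = 5 / 3 :> R.
Proof.
have l3 : ln 3 != 0 :> R by rewrite gt_eqF// ln_gt0// ltr1n.
rewrite inv_delta_sE /powR pnatr_eq0/= divfK// expRB !lnK ?posrE//.
Qed.

Lemma inv_delta_s_gt0 : 0 < 1 / delta_s R.
Proof.
rewrite inv_delta_sE divr_gt0// ?ln_gt0 ?ltr1n// subr_gt0.
by rewrite ltr_ln ?posrE// ltr_nat.
Qed.

End PowersOfThree.

(** * Shape and diameter of dyadic simplexes *)

Section DyadicSimplexes.
Context {R : realType}.
Variables (s : int -> bool) (c : int -> R * R).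
Hypothesis sc : cell_numbering s c.
Implicit Types (x y : R * R) (u v w : seq 'I_3) (k m : nat).

Lemma cell_expand k (j : int) : exists b u,
  contraction1_exp (- k%:Z) @` cell s c j = simplex b (size u + k) u.
Proof.
have [b [u ->]] := cell_simplex _ _ sc j; exists b, u.
by rewrite simplex_expand.
Qed.

Lemma cell_contract k (j : int) : exists b u,
  contraction1_exp k%:Z @` cell s c j = simplex b (size u) (nseq k ord0 ++ u).
Proof.
have [b [u ->]] := cell_simplex _ _ sc j; exists b, u.
by rewrite simplex_contract.
Qed.

(** Supplies a dyadic simplex for any prescribed word: the letters of v first choose the unit cell
    and, pushed back by the prepended letters 1, become its subdivision word. *)
Lemma contract_cell v : exists j : int,
  contraction1_exp (size v)%:Z @` cell s c j =
  simplex false (size v) (nseq (size v) ord0 ++ v).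
Proof.
have [j hj] := cell_unit _ _ sc false v; exists j.
rewrite -simplex_contract; congr image; apply: eq_imagel => x _.
exact: hj.
Qed.

Lemma scaled_cell_gasket (m : int) (j : int) :
  contraction1_exp m @` cell s c j `<=` @gasket R.
Proof.
case: m => k.
  by have [b [u ->]] := cell_contract k j; exact: simplex_gasket.
by rewrite NegzE; have [b [u ->]] := cell_expand k.+1 j; exact: simplex_gasket.
Qed.

Lemma dist_scaled_cell (m : int) (j : int) x y :
  euclidean_dist (contraction1_exp (- m) (tau s c j x))
    (contraction1_exp (- m) (tau s c j y)) = 2 ^ m * euclidean_dist x y.
Proof.
rewrite /euclidean_dist -[2 ^ m in RHS]ger0_norm ?exprz_ge0//.
rewrite -sqrtr_sqr -sqrtrM ?sqr_ge0//; congr Num.sqrt.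
rewrite !contraction1_expE opprK /tau.
by case: (s j) => /=; rewrite /GRing.scale /=; ring.
Qed.

Lemma diam_dyadic_simplex n (m : int) (i : 'I_n -> int) : (0 < n)%N ->
  diam (dyadic_simplex s c m i) = (2 ^ m)%:E.
Proof.
move=> n0; apply/eqP; rewrite eq_le; apply/andP; split.
  apply: ge_ereal_sup => _ [[p q] [hp hq] <-] /=; rewrite lee_fin.
  apply: bigmax_le => [|k _]; first exact: exprz_ge0.
  have [_ [x hx <-] <-] := hp k; have [_ [y hy <-] <-] := hq k.
  rewrite dist_scaled_cell ler_piMr ?exprz_ge0//.
  by apply: triangle_dist; exact: gasket0_triangle.
(* The diameter is attained at the points all of whose coordinates are the images of p_1,
   respectively p_2. *)
pose pt (l : 'I_3) (a : 'I_n) :=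
  contraction1_exp (- m) (tau s c (i a) (vertex R l)).
have hpt l a : (contraction1_exp (- m) @` cell s c (i a)) (pt l a).
  exists (tau s c (i a) (vertex R l)) => //.
  by exists (vertex R l) => //; exact: gasket0_vertex.
have gpt l a : pt l a \in @gasket R.
  by rewrite inE; exact: scaled_cell_gasket (hpt l a).
pose p l : gasket_power R n := fun a => exist _ (pt l a) (gpt l a).
apply: (@le_trans _ _ (max_dist (p ord0) (p (lift ord0 ord0)))%:E).
  rewrite lee_fin; apply: le_trans (le_bigmax _ _ (Ordinal n0)) => /=.
  rewrite dist_scaled_cell ler_peMr ?exprz_ge0//.
  by rewrite /euclidean_dist /= !subrr sub0r sqrrN expr1n expr0n addr0 sqrtr1.
apply: ereal_sup_ubound.
by exists (p ord0, p (lift ord0 ord0)) => //; split => a; exact: hpt.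
Qed.

End DyadicSimplexes.

(** * Masses of scaled cells in one factor *)

Section CellMeasures.
Context {R : realType}.
Variables (s : int -> bool) (c : int -> R * R).
Hypothesis sc : cell_numbering s c.
Variables nu mu : {measure set (borel (gasket_space R)) -> \bar R}.
Hypothesis nu_uniform : is_uniform_measure s c nu.
Hypothesis mu_kusuoka : is_kusuoka_measure s c mu.
Implicit Types (j : int) (k : nat) (v : seq 'I_3).

Definition scaled_cell (m : int) j : set (gasket_space R) :=
  trace_on_gasket (contraction1_exp (- m) @` cell s c j).

Lemma measurable_scaled_cell m j :
  measurable (scaled_cell m j : set (borel (gasket_space R))).
Proof.
rewrite /scaled_cell; case: m => k.
  by have [b [u ->]] := cell_expand _ _ sc k j; exact: measurable_simplex.
rewrite NegzE opprK.
by have [b [u ->]] := cell_contract _ _ sc k.+1 j; exact: measurable_simplex.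
Qed.

Lemma kusuoka_small_simplex b N w : (N <= size w)%N ->
  (mu (trace_on_gasket (simplex b N w)) <= ((3 / 5) ^+ (size w - N))%:E)%E.
Proof.
move=> Nw; rewrite (kusuoka_simplex _ _ sc _ mu_kusuoka)// lee_fin.
apply: le_trans (ler_wpM2l _ (kusuoka_energy_le _)) _; rewrite ?exprn_ge0//.
by rewrite size_drop -exprMn (_ : 15^-1 * 9 = 3 / 5)//; by field.
Qed.

Lemma uniform_small_simplex b N w : (N <= size w)%N ->
  (nu (trace_on_gasket (simplex b N w)) <= ((3 / 5) ^+ (size w - N))%:E)%E.
Proof.
move=> Nw; rewrite (uniform_simplex _ _ sc _ nu_uniform)// lee_fin.
by apply: lerXn2r; rewrite ?nnegrE; lra.
Qed.

Lemma kusuoka_expanded k j : mu (scaled_cell k j) = (3 ^+ k)%:E.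
Proof.
rewrite /scaled_cell; have [b [u ->]] := cell_expand _ _ sc k j.
rewrite large_simplex ?leq_addr ?addKn// => [b' u'|]; last first.
  exact: kusuoka_small_simplex.
rewrite (kusuoka_simplex _ _ sc _ mu_kusuoka)// subnn drop_size.
by rewrite kusuoka_energy_nil expr0 mulr1.
Qed.

Lemma uniform_expanded k j : nu (scaled_cell k j) = (3 ^+ k)%:E.
Proof.
rewrite /scaled_cell; have [b [u ->]] := cell_expand _ _ sc k j.
rewrite large_simplex ?leq_addr ?addKn// => [b' u'|]; last first.
  exact: uniform_small_simplex.
by rewrite (uniform_simplex _ _ sc _ nu_uniform)// subnn expr0.
Qed.

Lemma uniform_contracted k j : nu (scaled_cell (- k%:Z) j) = (3^-1 ^+ k)%:E.
Proof.
rewrite /scaled_cell opprK; have [b [u ->]] := cell_contract _ _ sc k j.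
have e : size (nseq k (ord0 : 'I_3) ++ u) = (k + size u)%N.
  by rewrite size_cat size_nseq.
by rewrite (uniform_simplex _ _ sc _ nu_uniform) e ?leq_addl// addnK.
Qed.

Lemma kusuoka_contracted k j : exists2 w, size w = k &
  mu (scaled_cell (- k%:Z) j) = (15^-1 ^+ k * kusuoka_energy w)%:E.
Proof.
rewrite /scaled_cell opprK; have [b [u ->]] := cell_contract _ _ sc k j.
have e : size (nseq k (ord0 : 'I_3) ++ u) = (k + size u)%N.
  by rewrite size_cat size_nseq.
exists (drop (size u) (nseq k ord0 ++ u)); first by rewrite size_drop e addnK.
by rewrite (kusuoka_simplex _ _ sc _ mu_kusuoka) e ?leq_addl// addnK.
Qed.

Lemma kusuoka_contracted_bounds k j : exists r : R,
  [/\ mu (scaled_cell (- k%:Z) j) = r%:E, 5^-1 ^+ k <= r & r <= (3 / 5) ^+ k].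
Proof.
have [w wk ->] := kusuoka_contracted k j; eexists; split; first reflexivity.
  have -> : 5^-1 ^+ k = 15^-1 ^+ k * 3 ^+ k :> R.
    by rewrite -exprMn; congr (_ ^+ _); field.
  by rewrite ler_wpM2l ?exprn_ge0// -wk; exact: kusuoka_energy_ge.
have -> : (3 / 5) ^+ k = 15^-1 ^+ k * 9 ^+ k :> R.
  by rewrite -exprMn; congr (_ ^+ _); field.
by rewrite ler_wpM2l ?exprn_ge0// -wk; exact: kusuoka_energy_le.
Qed.

Lemma kusuoka_prescribed v : exists j, mu (scaled_cell (- (size v)%:Z) j) =
  (15^-1 ^+ size v * kusuoka_energy v)%:E.
Proof.
have [j hj] := contract_cell _ _ sc v; exists j.
rewrite /scaled_cell opprK hj (kusuoka_simplex _ _ sc _ mu_kusuoka); last first.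
  by rewrite size_cat leq_addl.
by rewrite size_cat addnK drop_cat size_nseq ltnn subnn drop0.
Qed.

(** Serves the Radon property: a bounded region of the gasket lies in the union of 2^m S_0 and its
    opposite, two sets of finite mass. *)
Lemma kusuoka_bounded_set (r : R) : exists2 A : set (R * R), closed A &
  (forall x : gasket_space R, `|bary1 (val x) + bary2 (val x)| <= r ->
    A (val x)) /\ (mu (trace_on_gasket A) < +oo)%E.
Proof.
have [m rm] : exists m, r < 2 ^+ m.
  exists (Num.bound `|r|); apply: le_lt_trans (ler_norm _) _.
  apply: lt_le_trans (archi_boundP (normr_ge0 r)) _.
  by rewrite -natrX ler_nat; apply: ltnW; exact: ltn_expl.
exists (simplex false m [::] `|` simplex true m [::]).
  by apply: closedU; exact: closed_simplex.
split=> [x xr|].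
  have [] := gasket_bounded_simplex (val x) m; first by rewrite -inE; exact: valP.
    exact: le_lt_trans rm.
  by case=> h; [right|left].
have L b : mu (trace_on_gasket (simplex b m [::])) = (3 ^+ m)%:E.
  rewrite large_simplex ?subn0// => [b' u'|]; last exact: kusuoka_small_simplex.
  rewrite (kusuoka_simplex _ _ sc _ mu_kusuoka)// subnn drop_size.
  by rewrite kusuoka_energy_nil expr0 mulr1.
apply: (@le_lt_trans _ _ (mu (trace_on_gasket (simplex false m [::])) +
  mu (trace_on_gasket (simplex true m [::])))%E); last by rewrite !L -EFinD ltry.
by apply: measureU2; exact: measurable_simplex.
Qed.

End CellMeasures.

(** * Boxes and the Radon property *)

Section ProductMeasures.
Context {R : realType}.
Variable n : nat.

Lemma closed_box (A : 'I_n -> set (gasket_space R)) :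
  (forall a, closed (A a)) -> closed (box A).
Proof.
move=> cA; have -> : box A = \bigcap_(a in [set: 'I_n])
    (proj a : gasket_power R n -> gasket_space R) @^-1` A a.
  by apply/seteqP; split => [x h a _|x h a]; [exact: h|exact: (h a)].
apply: closed_bigI => a _; apply: preimage_closed => // x _.
exact: proj_continuous.
Qed.

Lemma box_measure (rho : {measure set (borel (gasket_space R)) -> \bar R})
    (rhon : {measure set (borel (gasket_power R n)) -> \bar R})
    (A : 'I_n -> set (borel (gasket_space R))) (f : 'I_n -> R) :
  is_product_measure rho rhon -> (forall a, measurable (A a)) ->
  (forall a, rho (A a) = (f a)%:E) -> rhon (box A) = (\prod_a f a)%:E.
Proof.
move=> H mA e; rewrite H// -prodEFin; apply: eq_bigr => a _; exact: e.
Qed.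

(** On a compact set [bary1 + bary2] is bounded in every coordinate, so the set lies in a box whose
    sides have finite mass, and the product formula applies to that box. *)
Lemma product_kusuoka_radon s c
    (mu : {measure set (borel (gasket_space R)) -> \bar R})
    (mun : {measure set (borel (gasket_power R n)) -> \bar R}) :
  cell_numbering s c -> is_kusuoka_measure s c mu ->
  is_product_measure mu mun -> radon_measure mun.
Proof.
move=> sc mu_kusuoka mun_prod K cK.
have clK : closed K.
  apply: compact_closed cK; apply: hausdorff_product => a.
  exact: hausdorff_gasket.
have bound (a : 'I_n) : exists A : set (R * R), [/\ closed A,
    forall x, K x -> A (val (x a)) & (mu (trace_on_gasket A) < +oo)%E].
  pose g (y : R * R) : R := bary1 y + bary2 y.
  pose f (x : gasket_power R n) : R * R := val (x a).
  have cg : continuous g.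
    by move=> y; exact: cvgD (continuous_bary1 y) (continuous_bary2 y).
  have cf : continuous f.
    move=> x; exact: (@continuous_comp (gasket_power R n) (gasket_space R)
      (R * R)%type (proj a) val x (@proj_continuous _ _ a x)
      (continuous_gasket_val _)).
  pose h := g \o f.
  have ch : continuous h.
    by move=> x; exact: continuous_comp (cf x) (cg (f x)).
  have /compact_bounded[M [_ hM]] : compact (h @` K).
    by apply: continuous_compact => //; exact: continuous_subspaceT.
  have [A clA [hA fA]] := kusuoka_bounded_set _ _ sc _ mu_kusuoka (M + 1).
  exists A; split => // x Kx; apply: hA.
  by apply: (hM (M + 1)); [rewrite ltrDl|exists x].
have [A hA] := fin_all_exists bound.
have mA a : measurable (trace_on_gasket (A a) : set (borel (gasket_space R))).
  by apply: measurable_trace; case: (hA a).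
apply: (@le_lt_trans _ _ (mun (box (fun a => trace_on_gasket (A a))))).
  apply: le_measure; rewrite ?inE.
  - by apply: measurable_generatorC; exact: closed_openC.
  - by apply: measurable_generatorC; apply: closed_openC;
      apply: closed_box => a; apply: closed_trace;
      case: (hA a).
  - by move=> x Kx a; case: (hA a) => _ /(_ x Kx).
rewrite (box_measure mu _ _ (fun a => fine (mu (trace_on_gasket (A a)))))// ?ltry//.
move=> a; rewrite fineK// ge0_fin_numE//; by case: (hA a).
Qed.

End ProductMeasures.

Lemma prod_const_ord {R : realType} n (r : R) : \prod_(a < n) r = r ^+ n.
Proof. by rewrite prodr_const card_ord. Qed.

Lemma fine_inve {R : realType} (d : \bar R) : (0 < d)%E ->
  (d = +oo%E /\ fine d^-1 = 0) \/
  exists r : R, [/\ d = r%:E, 0 < r & fine d^-1 = r^-1].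
Proof.
case: d => [r||//]; last by left; rewrite invey.
by rewrite lte_fin => r0; right; exists r; rewrite inver gt_eqF.
Qed.

Lemma geometric_le_pow {R : realType} n (a C x y : R) : (0 < n)%N ->
  0 < a -> 0 <= x -> 0 < y ->
  (forall k, a * (x ^+ k) ^+ n <= C * (y ^+ k) ^+ n) -> x <= y.
Proof.
move=> n0 a0 x0 y0 H; rewrite -(@ler_pXn2r _ n)// ?nnegrE ?(ltW y0)//.
apply: (@geometric_le _ a C) => // [|k]; first exact: exprn_gt0.
by rewrite ![_ ^+ n ^+ k]exprAC.
Qed.

(** * The two conditions and their sharpness *)

Section Conditions.
Context {R : realType}.
Variables (n : nat) (s : int -> bool) (c : int -> R * R).
Variables nu mu : {measure set (borel (gasket_space R)) -> \bar R}.
Variables nun mun : {measure set (borel (gasket_power R n)) -> \bar R}.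
Hypothesis n_gt0 : (0 < n)%N.
Hypothesis sc : cell_numbering s c.
Hypothesis nu_uniform : is_uniform_measure s c nu.
Hypothesis mu_kusuoka : is_kusuoka_measure s c mu.
Hypothesis nun_prod : is_product_measure nu nun.
Hypothesis mun_prod : is_product_measure mu mun.
Implicit Types (i : 'I_n -> int) (k : nat) (e r : R).

Local Notation D := (dyadic_simplex s c).
Local Notation L := (1 / delta_s R).

Lemma uniform_dyadic_large k i : nun (D k i) = ((3 ^+ k) ^+ n)%:E.
Proof.
rewrite (box_measure _ nu _ _ (fun=> 3 ^+ k))// ?prod_const_ord// => a.
  exact: measurable_scaled_cell.
exact: uniform_expanded.
Qed.

Lemma kusuoka_dyadic_large k i : mun (D k i) = ((3 ^+ k) ^+ n)%:E.
Proof.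
rewrite (box_measure _ mu _ _ (fun=> 3 ^+ k))// ?prod_const_ord// => a.
  exact: measurable_scaled_cell.
exact: kusuoka_expanded.
Qed.

Lemma uniform_dyadic_small k i : nun (D (- k%:Z) i) = ((3^-1 ^+ k) ^+ n)%:E.
Proof.
rewrite (box_measure _ nu _ _ (fun=> 3^-1 ^+ k))// ?prod_const_ord// => a.
  exact: measurable_scaled_cell.
exact: uniform_contracted.
Qed.

Lemma kusuoka_dyadic_small k i : exists2 r, mun (D (- k%:Z) i) = r%:E &
  (5^-1 ^+ k) ^+ n <= r <= ((3 / 5) ^+ k) ^+ n.
Proof.
have [f hf] := fin_all_exists
  (fun a => kusuoka_contracted_bounds s c sc mu mu_kusuoka k (i a)).
exists (\prod_a f a).
  apply: (box_measure _ mu) => // a; first exact: measurable_scaled_cell.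
  by case: (hf a).
rewrite -(prod_const_ord n (5^-1 ^+ k)) -(prod_const_ord n ((3 / 5) ^+ k));
  apply/andP; split; apply: ler_prod => a _.
  by case: (hf a) => _ -> _; rewrite exprn_ge0.
case: (hf a) => _ h ->; rewrite andbT; apply: le_trans h.
by rewrite exprn_ge0.
Qed.

Lemma kusuoka_dyadic_prescribed v : exists i, mun (D (- (size v)%:Z) i) =
  ((15^-1 ^+ size v * kusuoka_energy v) ^+ n)%:E.
Proof.
have [j hj] := kusuoka_prescribed s c sc mu mu_kusuoka v; exists (fun=> j).
rewrite (box_measure _ mu _ _ (fun=> 15^-1 ^+ size v * kusuoka_energy v))//.
  by rewrite prod_const_ord.
by move=> a; exact: measurable_scaled_cell.
Qed.

Lemma poweR_large k e : ((((3 : R) ^+ k) ^+ n)%:E `^ e)%E =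
  (((3 `^ e) ^+ k) ^+ n)%:E.
Proof. by rewrite poweR_EFin !powRXn ?exprn_ge0. Qed.

Lemma poweR_small k e : ((((3^-1 : R) ^+ k) ^+ n)%:E `^ e)%E =
  (((3 `^ (- e)) ^+ k) ^+ n)%:E.
Proof. by rewrite poweR_EFin !powRXn ?exprn_ge0 ?powR_third. Qed.

Lemma diam_large k i : (1 < diam (D k.+1 i))%E.
Proof.
by rewrite diam_dyadic_simplex// lte_fin -exprnP exprn_egt1// ltr1n.
Qed.

Lemma diam_small k i : (0 < diam (D (- k%:Z) i) <= 1)%E.
Proof.
rewrite diam_dyadic_simplex// lte_fin lee_fin exprz_gt0//=.
by rewrite -exprz_inv -exprnP exprn_ile1// invf_le1// ler1n.
Qed.

Lemma dyadic_simplex_dyadic (m : int) i : is_dyadic_simplex s c (D m i).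
Proof. by exists m, i. Qed.

Lemma dyadicP (P : set (gasket_power R n) -> Prop) :
  (forall k i, P (D k i)) -> (forall k i, P (D (- k%:Z) i)) ->
  forall S, is_dyadic_simplex s c S -> P S.
Proof. by move=> h h' S [[k|k] [i ->]] => //; exact: (h' k.+1). Qed.

Lemma delta_s_gt0 : 0 < delta_s R.
Proof. by rewrite -invr_gt0 -div1r inv_delta_s_gt0. Qed.

Lemma delta_s_ge1 : 1 <= delta_s R.
Proof.
rewrite -(@invf_le1 _ (delta_s R)) ?delta_s_gt0// -div1r.
rewrite -(@ler_powR_exponent _ 3) ?ltr1n// powR_inv_delta_s powRr1//; lra.
Qed.

Lemma powR_1D_inv_delta_s : 3 `^ (1 + L) = 5.
Proof.
rewrite powRD ?pnatr_eq0 ?implybT// powR_inv_delta_s powRr1//; by field.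
Qed.

Lemma kusuoka_condition_M : condition_M s c nun mun 1%E (delta_s R)%:E.
Proof.
split; rewrite ?lte_fin ?lee_fin ?delta_s_ge1//.
  exact: product_kusuoka_radon sc mu_kusuoka mun_prod.
(* The constant 1 suffices: nu and mu agree on large cells, and on small ones 3/5 is exactly 3 to
   the power -1/delta_s. *)
exists 1; split => //; apply: dyadicP => k i.
  rewrite uniform_dyadic_large kusuoka_dyadic_large inve1 poweRe1 ?mul1e//.
  (* For k = 0 the diameter is 1, which falls under the small case; both masses are then 1 and any
     exponent works. *)
  split => // /andP[_]; case: k => [|k]; last by rewrite leNgt diam_large.
  by rewrite !expr0 !expr1n poweR1r.
rewrite uniform_dyadic_small mul1e.
have [r -> /andP[_ h]] := kusuoka_dyadic_small k i.
split => [_|]; last first.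
  by rewrite ltNge; case/andP: (diam_small k i) => _ ->.
rewrite poweR_small lee_fin inver gt_eqF ?delta_s_gt0//=.
rewrite powRN -[(delta_s R)^-1]div1r powR_inv_delta_s (_ : (5 / 3)^-1 = 3 / 5)//.
by field.
Qed.

Lemma kusuoka_condition_M' :
  condition_M' s c nun mun ((1 + L)^-1)%:E 1%E.
Proof.
have L0 := @inv_delta_s_gt0 R.
have L1 : 0 < 1 + L by rewrite addr_gt0.
have iL : (1 + L)^-1 <= 1 by rewrite invf_le1// lerDl ltW.
split; rewrite ?lte_fin ?lee_fin ?invr_gt0//.
  exact: product_kusuoka_radon sc mu_kusuoka mun_prod.
exists 1; split => //; apply: dyadicP => k i.
  rewrite uniform_dyadic_large kusuoka_dyadic_large inve1 poweRe1 ?invr1 ?mul1e//.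
  split => // /andP[_]; case: k => [|k]; last by rewrite leNgt diam_large.
  by rewrite !expr0 !expr1n poweR1r.
rewrite uniform_dyadic_small invr1 mul1e.
have [r -> /andP[h _]] := kusuoka_dyadic_small k i.
split => [_|]; last first.
  by rewrite ltNge; case/andP: (diam_small k i) => _ ->.
rewrite poweR_small lee_fin inver gt_eqF ?invr_gt0//= invrK.
by rewrite powRN powR_1D_inv_delta_s.
Qed.

Lemma condition_M_bounds dlo dup : condition_M s c nun mun dlo dup ->
  (dlo <= 1)%E /\ ((delta_s R)%:E <= dup)%E.
Proof.
move=> [_ dlo0 dlodup _ [C [C0 H]]]; split.
  have e1 : 1 <= fine dlo^-1.
    rewrite -(@ler_powR_exponent _ 3) ?ltr1n// powRr1//.
    (* Only diameters above 1 are usable, so the scale is k + 1; the extra factor on each side is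
       absorbed in the constants. *)
    apply: (@geometric_le_pow _ n (3 ^+ n) (C * (3 `^ (fine dlo^-1)) ^+ n));
      rewrite ?exprn_gt0 ?powR_gt0// => k.
    have [_ /(_ (diam_large k (fun=> 0)))] :=
    H _ (dyadic_simplex_dyadic k.+1 (fun=> 0)).
    rewrite uniform_dyadic_large kusuoka_dyadic_large poweR_large -EFinM lee_fin.
    by rewrite !exprS !exprMn mulrA.
  have [[_ e0]|[r [dloE r0 er]]] := fine_inve dlo dlo0.
    by move: e1; rewrite e0 ler10.
  by move: e1; rewrite er dloE lee_fin invf_ge1.
have [[-> _]|[r [dupE r0 er]]] := fine_inve dup (lt_le_trans dlo0 dlodup).
  exact: leey.
rewrite [in leRHS]dupE lee_fin -lef_pV2 ?posrE ?delta_s_gt0// -er -div1r -lerN2.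
rewrite -(@ler_powR_exponent _ 3) ?ltr1n// [leLHS]powRN powR_inv_delta_s.
rewrite (_ : (5 / 3)^-1 = 3 / 5); last by field.
(* The words 1...1 of length k have mass at least (3/5)^k / 3 in each factor, whence the constant
   3^(-n). *)
apply: (@geometric_le_pow _ n (3^-1 ^+ n) C);
  rewrite ?exprn_gt0 ?powR_gt0 ?divr_ge0// => k.
have [i hi] := kusuoka_dyadic_prescribed (nseq k ord0).
rewrite size_nseq in hi.
have [/(_ (diam_small k i)) + _] := H _ (dyadic_simplex_dyadic (- k%:Z) i).
rewrite hi uniform_dyadic_small poweR_small -EFinM lee_fin. apply: le_trans.
rewrite -exprMn; apply: lerXn2r; rewrite ?nnegrE.
- by apply: mulr_ge0 => //; rewrite exprn_ge0// divr_ge0.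
- by apply: mulr_ge0; [rewrite exprn_ge0|exact: kusuoka_energy_ge0].
apply: (@le_trans _ _ (15^-1 ^+ k * (9 ^+ k / 3))); last first.
  by rewrite ler_wpM2l ?exprn_ge0// kusuoka_energy_nseq0.
by rewrite mulrA -exprMn mulrC (_ : 15^-1 * 9 = 3 / 5)//; field.
Qed.

Lemma condition_M'_bounds dlo dup : condition_M' s c nun mun dlo dup ->
  (dlo <= ((1 + L)^-1)%:E)%E /\ (1 <= dup)%E.
Proof.
move=> [_ dlo0 dlodup dlo1 [C [C0 H]]].
have L0 := @inv_delta_s_gt0 R.
have L1 : 0 < 1 + L by rewrite addr_gt0.
split.
  have [[ey _]|[r [dloE r0 er]]] := fine_inve dlo dlo0.
    by move: dlo1; rewrite ey.
  rewrite dloE lee_fin -lef_pV2 ?posrE ?invr_gt0// invrK -er -lerN2.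
  rewrite -(@ler_powR_exponent _ 3) ?ltr1n// [leRHS]powRN powR_1D_inv_delta_s.
  (* The test words (123)^k have length 3k, so the ratios are compared after cubing; the constant
     4^n comes from the energy bound for these words. *)
  rewrite -(@ler_pXn2r _ 3) ?nnegrE ?powR_ge0//.
  apply: (@geometric_le_pow _ n C^-1 (4 ^+ n));
    rewrite ?exprn_gt0 ?exprn_ge0 ?powR_ge0 ?invr_gt0// => k.
  have [i hi] := kusuoka_dyadic_prescribed (cyclic_word k).
  rewrite size_cyclic_word in hi.
  have [/(_ (diam_small (3 * k) i)) + _] :=
    H _ (dyadic_simplex_dyadic (- (3 * k)%N%:Z) i).
  rewrite hi uniform_dyadic_small poweR_small -EFinM lee_fin -!exprM.
  rewrite !mulnA !(exprM _ (3 * k)) => h; apply: (le_trans h); rewrite -exprMn.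
  apply: lerXn2r; rewrite ?nnegrE.
  - by apply: mulr_ge0; [rewrite exprn_ge0|exact: kusuoka_energy_ge0].
  - by apply: mulr_ge0 => //; rewrite exprn_ge0.
  apply: (@le_trans _ _ (15^-1 ^+ (3 * k) * (4 * 27 ^+ k))).
    by rewrite ler_wpM2l ?exprn_ge0// kusuoka_energy_cyclic.
  rewrite mulrCA exprM -exprMn exprM (_ : 15^-1 ^+ 3 * 27 = 5^-1 ^+ 3)//.
  by field.
have [[-> _]|[r [dupE r0 er]]] := fine_inve dup (lt_le_trans dlo0 dlodup).
  exact: leey.
rewrite [in leRHS]dupE lee_fin -invf_le1// -er
  -(@ler_powR_exponent _ 3) ?ltr1n// powRr1//.
(* As nu and mu agree on large simplexes, the upper exponent cannot exceed 1. *)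
apply: (@geometric_le_pow _ n (C^-1 * (3 `^ (fine dup^-1)) ^+ n) (3 ^+ n));
  rewrite ?mulr_gt0 ?exprn_gt0 ?powR_gt0 ?powR_ge0 ?invr_gt0// => k.
have [_ /(_ (diam_large k (fun=> 0)))] :=
    H _ (dyadic_simplex_dyadic k.+1 (fun=> 0)).
rewrite uniform_dyadic_large kusuoka_dyadic_large poweR_large -EFinM lee_fin.
by rewrite !exprS !exprMn mulrA.
Qed.

End Conditions.

Theorem corollary4p2 (R : realType) (n : nat) (n_ge1 : (1 <= n)%N)
  (s : int -> bool) (c : int -> R * R) (sc_cells : cell_numbering s c)
  (nu mu : {measure set (borel (gasket_space R)) -> \bar R})
  (nu_uniform : is_uniform_measure s c nu)
  (mu_kusuoka : is_kusuoka_measure s c mu)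
  (nun mun : {measure set (borel (gasket_power R n)) -> \bar R})
  (nun_prod : is_product_measure nu nun)
  (mun_prod : is_product_measure mu mun) :
  (condition_M s c nun mun 1%E (delta_s R)%:E /\
   forall dlo dup : \bar R, condition_M s c nun mun dlo dup ->
     (dlo <= 1)%E /\ ((delta_s R)%:E <= dup)%E) /\
  (condition_M' s c nun mun ((1 + 1 / delta_s R)^-1)%:E 1%E /\
   forall dlo dup : \bar R, condition_M' s c nun mun dlo dup ->
     (dlo <= ((1 + 1 / delta_s R)^-1)%:E)%E /\ (1 <= dup)%E).
Proof.
split; split.
- exact: (@kusuoka_condition_M R n s c nu mu).
- exact: (@condition_M_bounds R n s c nu mu).
- exact: (@kusuoka_condition_M' R n s c nu mu).
- exact: (@condition_M'_bounds R n s c nu mu).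
Qed.
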